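(* Let ${\mathfrak D}$ be an unbounded LMI region such that ${\mathfrak D}\cap{\mathbb R}={\mathbb R}_-=(-\infty,0)$. If a real $n\times n$ matrix ${\mathbf A}$ is diagonally ${\mathfrak D}$-dominant, then ${\mathbf A}$ is ${\mathfrak D}$-stable, i.e. $\sigma({\mathbf A})\subset{\mathfrak D}$. Moreover, every matrix of the form ${\mathbf D}{\mathbf A}$ with ${\mathbf D}\in{\mathcal D}^+_{(0,1]}$ is also ${\mathfrak D}$-stable.
   Context: $\sigma({\mathbf A})$ is the set of eigenvalues of ${\mathbf A}$. ${\mathcal D}^+_{(0,1]}$ is the set of $n\times n$ diagonal matrices ${\rm diag}\{d_{11},\ldots,d_{nn}\}$ with $0<d_{ii}\le 1$ for all $i$. An LMI region is a (nonempty) set ${\mathfrak D}=\{z\in{\mathbb C}: {\mathbf L}+z{\mathbf M}+\overline{z}{\mathbf M}^T\prec 0\}$ (negative definite), where ${\mathbf L},{\mathbf M}$ are real square matrices of the same size and ${\mathbf L}^T={\mathbf L}$. It is open, convex and symmetric about the real axis. For ${\mathfrak D}\cap{\mathbb R}=(\alpha,\beta)$ put $y(x)=\sup\{y: x+iy\in{\mathfrak D}\}$ for $x\in(\alpha,\beta)$ and $m(x)=\min(|x-\alpha|,|x-\beta|)$ (an infinite term is ignored if the other is finite); here $(\alpha,\beta)=(-\infty,0)$ and $m(x)=|x|$. If $y(x)$ is finite (${\mathfrak D}$ bounded from above), $r(x)=\dfrac{m(x)\,y(x)}{\sqrt{m(x)^2+y(x)^2}}$; if $y(x)=+\infty$ (${\mathfrak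 D}$ unbounded from above; here a half-plane), $r(x)=m(x)$. A real $n\times n$ matrix ${\mathbf A}=\{a_{ij}\}$ is diagonally ${\mathfrak D}$-dominant if $a_{ii}\in(\alpha,\beta)$ and $r(a_{ii})>\sum_{j\neq i}|a_{ij}|$ for all $i=1,\ldots,n$. *)

(* Defs.v *)
From HB Require Import structures.
From mathcomp Require Export all_boot all_order all_algebra.
From mathcomp Require Export all_classical all_reals all_analysis.
From mathcomp Require Export complex.

#[export] Set Implicit Arguments.
#[export] Unset Strict Implicit.
#[export] Unset Printing Implicit Defensive.

Export Order.TTheory GRing.Theory Num.Theory.
Export numFieldNormedType.Exports.

Local Open Scope classical_set_scope.
Local Open Scope ring_scope.
Local Open Scope sesquilinear_scope.

Definition negdefmx (C : numClosedFieldType) (m : nat) (H : 'M[C]_m) : Prop :=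
  H \is hermsymmx /\
  forall v : 'cV[C]_m, v != 0 -> (v ^t* *m H *m v) 0 0 < 0.

Definition complexmx (R : rcfType) (m n : nat) (A : 'M[R]_(m, n)) :
  'M[R[i]]_(m, n) := map_mx (real_complex R) A.

Definition lmi_set (R : rcfType) (m : nat) (L M : 'M[R]_m) : set R[i] :=
  [set z | negdefmx (complexmx L + z *: complexmx M + z^* *: complexmx M^T)].

Definition is_lmi_region (R : realType) (D : set R[i]) : Prop :=
  D !=set0 /\
  exists m (L M : 'M[R]_m), L^T = L /\ D = lmi_set L M.

Definition real_section (R : realType) (D : set R[i]) : set R :=
  [set x | D x%:C%C].

(* For an LMI region, D `&` R is an open interval; these are its (possibly
   infinite) endpoints alpha and beta. *)
Definition left_end (R : realType) (D : set R[i]) : \bar R :=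
  ereal_inf [set x%:E | x in real_section D].

Definition right_end (R : realType) (D : set R[i]) : \bar R :=
  ereal_sup [set x%:E | x in real_section D].

Definition height (R : realType) (D : set R[i]) (x : R) : \bar R :=
  ereal_sup [set y%:E | y in [set y | D (x +i* y)%C]].

(* An infinite endpoint is at distance +oo from x, so it does not affect the
   minimum when the other endpoint is finite. *)
Definition end_dist (R : realType) (D : set R[i]) (x : R) : \bar R :=
  mine `|x%:E - left_end D|%E `|x%:E - right_end D|%E.

(* When m = +oo (D contains the whole real line) or y = +oo, the value is the
   limit of m y / sqrt (m^2 + y^2).  The last case, y = -oo, is the one where
   the vertical line through x misses D. *)
Definition radius (R : realType) (D : set R[i]) (x : R) : \bar R :=
  match end_dist D x, height D x with
  | m%:E, y%:E => (m * y / Num.sqrt (m ^+ 2 + y ^+ 2))%:E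
  | m, +oo => m
  | +oo, y => y
  | _, _ => -oo
  end%E.

Definition diag_dominant (R : realType) (D : set R[i]) (n : nat)
    (A : 'M[R]_n) : Prop :=
  forall i : 'I_n,
    [/\ (left_end D < (A i i)%:E)%E, ((A i i)%:E < right_end D)%E &
        ((\sum_(j < n | j != i) `|A i j|)%:E < radius D (A i i))%E].

Definition spectrum (R : realType) (n : nat) (A : 'M[R]_n) : set R[i] :=
  [set z | eigenvalue (complexmx A) z].

Definition stable_in (R : realType) (D : set R[i]) (n : nat)
    (A : 'M[R]_n) : Prop := spectrum A `<=` D.

Definition diag_pos_le1 (R : realType) (n : nat) : set 'M[R]_n :=
  [set E | exists2 d : 'rV[R]_n, E = diag_mx d & forall i, 0 < d 0 i <= 1].

(* Main.v *)
Require Import Defs.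
From mathcomp Require Import ring lra.

(** The set of negative definite matrices is a convex cone that is stable under
transposition. Since the pencil [L + z M + z^* M^T] depends on [z] affinely
over the reals, and conjugating [z] transposes it when [L] is symmetric, an LMI
region is convex ([lmi_set_convex]) and symmetric about the real axis
([lmi_set_conj]).

By Gershgorin's theorem an eigenvalue of [E A], with [E = diag d], lies for
some row [i] in the disc of center [d_i x] and radius [d_i S], where
[x = A i i < 0] and [S] is the sum of the moduli of the other entries of that
row of [A]. So the task is to place these discs in [D]. As [D] contains the
open negative axis, convexity and symmetry show that [D] contains, together
with [x + iy], every [u + iv] such that [u < 0], [|v| < y] and
[|v| / -u < y / -x] ([cone_mem]): these are the points of the horizontal strip of half-width [y]
that also lie in the open sector, with apex 0 and axis the negative half-line,
whose boundary rays pass through [x + iy] and [x - iy].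

The radius [r = -x y / sqrt (x^2 + y^2)] is the distance from [x] to the sides
of this sector, and it is smaller than [y]. Shrinking the disc of center [x]
and radius [S < r] by a factor [d <= 1] towards the apex keeps it in the
sector, which is a cone, and in the strip, since [d S < y]
([disc_below_height]). If the height is infinite, the same description applies
with [y] as large as desired, and only [u < 0] remains to be checked; this is
what [r = -x] says. The first claim is the case [E = 1]. *)

Local Open Scope classical_set_scope.
Local Open Scope ring_scope.

Lemma negdefmx_tr (C : numClosedFieldType) (m : nat) (H : 'M[C]_m) :
  negdefmx H -> negdefmx H^T.
Proof.
case=> Hh Hneg; split.
  apply/is_hermitianmxP; rewrite expr0 scale1r.
  have /is_hermitianmxP := Hh; rewrite expr0 scale1r => {1}->.
  by rewrite map_trmx.
move=> v v0.
pose w := map_mx Num.conj v.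
have w0 : w != 0.
  apply: contraNneq v0 => /(congr1 (map_mx Num.conj)).
  by rewrite map_mx0 map_mxCK => ->.
suff -> : (v ^t* *m H^T *m v)%sesqui 0 0 = (w ^t* *m H *m w)%sesqui 0 0 by exact: Hneg.
have -> : (w ^t*)%sesqui = v^T by rewrite /w map_trmx map_mxCK.
have -> : (v ^t*)%sesqui = w^T by rewrite /w map_trmx.
transitivity ((w^T *m H^T *m v)^T 0 0); first by rewrite [RHS]mxE.
by rewrite !trmx_mul !trmxK mulmxA.
Qed.

Lemma negdefmx_convex (C : numClosedFieldType) (m : nat) (H K : 'M[C]_m) (s t : C) :
  0 <= s -> 0 <= t -> s + t = 1 -> negdefmx H -> negdefmx K ->
  negdefmx (s *: H + t *: K).
Proof.
move=> s0 t0 st1 [/is_hermitianmxP Hh Hn] [/is_hermitianmxP Kh Kn]; split.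
  move: Hh Kh; rewrite expr0 !scale1r => Hh Kh.
  apply/is_hermitianmxP; rewrite expr0 scale1r.
  rewrite linearD !linearZ /= map_mxD !map_mxZ -Hh -Kh.
  by congr (_ *: _ + _ *: _); rewrite [RHS](CrealP _) // ger0_real.
move=> v v0; rewrite mulmxDr mulmxDl -!scalemxAr -!scalemxAl.
rewrite [ltLHS]mxE [X in X + _]mxE [X in _ + X]mxE.
have [s_eq0|s_neq0] := eqVneq s 0.
  by move: st1; rewrite s_eq0 mul0r !add0r => ->; rewrite mul1r; exact: Kn.
have s_gt0 : 0 < s by rewrite lt0r s_neq0.
by rewrite ltr_wnDr ?mulr_ge0_le0 ?(ltW (Kn v v0))// pmulr_rlt0// Hn.
Qed.

Lemma affine_pencil_comb (C : comNzRingType) (m : nat) (L M N : 'M[C]_m)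
    (s t z w z' w' : C) :
  s + t = 1 ->
  L + (s * z + t * w) *: M + (s * z' + t * w') *: N =
  s *: (L + z *: M + z' *: N) + t *: (L + w *: M + w' *: N).
Proof.
move=> st1; apply/matrixP => i j; rewrite !mxE -[X in X + _ + _ = _]mul1r -st1.
ring.
Qed.

Lemma conj_real_comb (C : numClosedFieldType) (s t z w : C) :
  0 <= s -> 0 <= t -> (s * z + t * w)^* = s * z^* + t * w^*.
Proof.
move=> s0 t0; rewrite rmorphD !rmorphM /=.
by rewrite (conj_Creal (ger0_real s0)) (conj_Creal (ger0_real t0)).
Qed.

(** Convexity is proved over an abstract field [C], before specializing to
[R[i]]: there, unification unfolds the concrete complex operations and becomes
intractable. *)
Lemma negdefmx_pencil_convex (C : numClosedFieldType) (m : nat)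
    (L M N : 'M[C]_m) (s t z w : C) :
  0 <= s -> 0 <= t -> s + t = 1 ->
  negdefmx (L + z *: M + z^* *: N) -> negdefmx (L + w *: M + w^* *: N) ->
  negdefmx (L + (s * z + t * w) *: M + (s * z + t * w)^* *: N).
Proof.
move=> s0 t0 st1 Dz Dw; rewrite conj_real_comb// affine_pencil_comb//.
exact: negdefmx_convex.
Qed.

Lemma negdefmx_pencil_conj (C : numClosedFieldType) (m : nat)
    (L M : 'M[C]_m) (z : C) :
  L^T = L -> negdefmx (L + z *: M + z^* *: M^T) ->
  negdefmx (L + z^* *: M + z^*^* *: M^T).
Proof.
move=> Lsym /negdefmx_tr.
by rewrite conjCK !linearD !linearZ /= trmxK Lsym addrAC.
Qed.

Lemma lmi_set_convex (R : rcfType) (m : nat) (L M : 'M[R]_m) (s t : R) z w :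
  0 <= s -> 0 <= t -> s + t = 1 -> lmi_set L M z -> lmi_set L M w ->
  lmi_set L M (s%:C%C * z + t%:C%C * w).
Proof.
move=> s0 t0 st1; apply: negdefmx_pencil_convex; rewrite ?lecR//.
by rewrite -rmorphD st1.
Qed.

Lemma lmi_set_conj (R : rcfType) (m : nat) (L M : 'M[R]_m) z :
  L^T = L -> lmi_set L M z -> lmi_set L M z^*.
Proof.
move=> Lsym; rewrite /lmi_set /= /complexmx -map_trmx.
by apply: negdefmx_pencil_conj; rewrite map_trmx Lsym.
Qed.

(** Compare the moduli in the coordinate of an eigenvector that has the largest
modulus. The eigenvectors of [eigenvalue] are row vectors, whereas row sums of
[A] call for a column eigenvector; one exists because [A - z] and its transpose
are singular together. *)
Lemma gershgorin (C : numFieldType) (n : nat) (A : 'M[C]_n) z :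
  eigenvalue A z ->
  exists i, `|z - A i i| <= \sum_(j < n | j != i) `|A i j|.
Proof.
move=> ev.
have [v Av v0] : exists2 v : 'cV_n, A *m v = z *: v & v != 0.
  have : (A - z%:M)^T \notin unitmx.
    by rewrite unitmx_tr -row_free_unit -kermx_eq0.
  rewrite -row_free_unit -kermx_eq0 => /rowV0Pn[w /sub_kermxP wA w0].
  exists w^T; last by rewrite -(inj_eq trmx_inj) trmxK trmx0.
  apply: trmx_inj; rewrite trmx_mul trmxK linearZ /= trmxK.
  apply/eqP; rewrite -subr_eq0 -mul_mx_scalar -mulmxBr.
  by rewrite -[z%:M]tr_scalar_mx -linearB /= wA.
have /cV0Pn [i0 vi0] := v0.
have [||i _ imax] := @real_arg_maxP C 'I_n i0 predT (fun i => `|v i 0|) => //.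
have vi_gt0 : 0 < `|v i 0|.
  by apply: lt_le_trans (imax i0 isT); rewrite normr_gt0.
exists i; rewrite -(ler_pM2r vi_gt0) -normrM mulrBl.
have -> : z * v i 0 - A i i * v i 0 = \sum_(j < n | j != i) A i j * v j 0.
  have /matrixP /(_ i 0) := Av; rewrite !mxE (bigD1 i) //= => <-.
  by rewrite addrAC subrr add0r.
rewrite mulr_suml (le_trans (ler_norm_sum _ _ _)) // ler_sum // => j _.
rewrite normrM; apply: ler_wpM2l => //; exact: imax.
Qed.

(** For [0 <= v], the point [u + iv] lies on the segment from [x + iy] to a
point of the real axis, the weight of [x + iy] being [v / y]. The sector
condition says that this real point is negative. *)
Lemma cone_mem (R : realType) (D : set R[i]) (x y u v : R) :
  (forall (s t : R) z w, 0 <= s -> 0 <= t -> s + t = 1 -> D z -> D w ->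
    D (s%:C%C * z + t%:C%C * w)) ->
  (forall z, D z -> D z^*) ->
  (forall a : R, a < 0 -> D a%:C%C) ->
  D (x +i* y)%C -> `|v| < y -> - x * `|v| < - u * y -> D (u +i* v)%C.
Proof.
move=> Dconv Dconj Dneg Dxy vy xv.
wlog v0 : v vy xv / 0 <= v.
  move=> th; have [|/ltW v0] := leP 0 v; first exact: th.
  have -> : (u +i* v)%C = ((u +i* (- v))%C)^*.
    by apply/eqP; rewrite eq_complex /= opprK !eqxx.
  by apply/Dconj/th; rewrite ?normrN// oppr_ge0.
rewrite (ger0_norm v0) in vy xv.
have y0 : 0 < y by exact: le_lt_trans vy.
pose t := v / y.
have t0 : 0 <= t by rewrite divr_ge0// ltW.
have t1 : t < 1 by rewrite ltr_pdivrMr// mul1r.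
have s0 : 0 < 1 - t by rewrite subr_gt0.
have ty : t * y = v by rewrite divfK ?gt_eqF.
have -> : (u +i* v)%C =
    t%:C%C * (x +i* y)%C + (1 - t)%:C%C * ((u - t * x) / (1 - t))%:C%C.
  simpc.
  apply/eqP; rewrite eq_complex /=; apply/andP; split; apply/eqP.
    by rewrite (mulrC (1 - t)) divfK ?gt_eqF//; ring.
  by rewrite ty.
apply: Dconv => //; [exact: ltW|by rewrite addrC subrK|apply: Dneg].
rewrite pmulr_llt0 ?invr_gt0// -(pmulr_llt0 _ y0) mulrBl mulrAC ty; lra.
Qed.

(** As [u] is negative, the maximum is the greatest lower bound of the heights [y] for which the
strip and the sector of [cone_mem] contain [u + iv]. Comparing it with the
height itself, rather than with one point of [D] above [x], allows for a height
that is not attained and treats infinite heights at the same time. *)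
Lemma disc_below_height (R : realType) (D : set R[i]) (x d S u v : R) :
  end_dist D x = (- x)%:E ->
  x < 0 -> 0 < d <= 1 -> 0 <= S -> (S%:E < radius D x)%E ->
  (u - d * x) ^+ 2 + v ^+ 2 <= (d * S) ^+ 2 ->
  u < 0 /\ ((Num.max `|v| (- x * `|v| / - u))%:E < height D x)%E.
Proof.
move=> Dx x0 /andP[d0 d1] S0; rewrite /radius Dx.
have dS0 : 0 <= d * S by rewrite mulr_ge0// ltW.
move=> Sr disc.
have u0 : S < - x -> u < 0.
  move=> Sx; have : `|u - d * x| <= d * S.
    by rewrite -(ler_pXn2r (n := 2)) ?nnegrE// real_normK ?num_real// (le_trans _ disc)// lerDl sqr_ge0.
  rewrite ler_norml => /andP[_]; nra.
case: (height D x) Sr => [y| |]; rewrite /= ?lte_fin //; last by move=> /u0; rewrite ltry.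
set N := Num.sqrt _ => Sr.
have N0 : 0 < N by rewrite sqrtr_gt0; nra.
have N2 : N ^+ 2 = x ^+ 2 + y ^+ 2.
  by rewrite sqr_sqrtr ?sqrrN //; nra.
move: Sr; rewrite ltr_pdivlMr // => Sr.
have y0 : 0 < y by nra.
have yN : y <= N by nra.
have xN : - x <= N by nra.
have Sx : S < - x by nra.
have Sy : S < y by nra.
split; first exact: u0.
have vdS : `|v| <= d * S.
  by rewrite -(ler_pXn2r (n := 2)) ?nnegrE// real_normK ?num_real// (le_trans _ disc)// lerDr sqr_ge0.
rewrite gt_max ltr_pdivrMr ?oppr_gt0 ?u0//; apply/andP; split; first nra.
(* Cauchy-Schwarz for (u - d x, |v|) and (y, -x): this bounds how much closer
   than the center d x a point of the disc can be to the side of the sector. *)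
have CS : - x * `|v| + (u - d * x) * y <= d * S * N.
  apply: le_trans (ler_norm _) _.
  rewrite -(ler_pXn2r (n := 2)) ?nnegrE ?mulr_ge0// ?(ltW N0)// ?(ltW d0)// real_normK ?num_real//.
  rewrite exprMn N2; move: disc; rewrite -(real_normK (num_real v)); set p := `|v| => disc.
  apply: (@le_trans _ _ (((u - d * x) ^+ 2 + p ^+ 2) * (x ^+ 2 + y ^+ 2)));
    last by rewrite ler_wpM2r// addr_ge0// sqr_ge0.
  rewrite -subr_ge0.
  (* Lagrange's identity *)
  have -> (w : R) : (w ^+ 2 + p ^+ 2) * (x ^+ 2 + y ^+ 2)
      - (- x * p + w * y) ^+ 2 = (w * x + p * y) ^+ 2 by ring.
  exact: sqr_ge0.
nra.
Qed.

Lemma left_end_neg (R : realType) (D : set R[i]) :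
  real_section D = `]-oo, 0[%classic -> left_end D = -oo%E.
Proof.
move=> Dr; rewrite /left_end Dr.
have lb (x : R) : x < 0 -> (ereal_inf [set a%:E | a in `]-oo, 0%R[ : set R] <= x%:E)%E.
  by move=> x0; apply: ereal_inf_lbound; exists x; rewrite //= in_itv.
case: ereal_inf lb => [r| |//] lb.
  have : Num.min r 0 - 1 < 0 by rewrite subr_lt0 gt_min ltr01 orbT.
  by move/lb; rewrite lee_fin leNgt ltrBlDr gt_min ltrDl ltr01.
by have := lb (-1); rewrite ltrN10 => /(_ isT).
Qed.

Lemma right_end_neg (R : realType) (D : set R[i]) :
  real_section D = `]-oo, 0[%classic -> right_end D = 0%E.
Proof.
move=> Dr; rewrite /right_end Dr; apply/eqP; rewrite eq_le; apply/andP; split.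
  by apply: ge_ereal_sup => _ [x /= + <-]; rewrite in_itv /= lee_fin => /ltW.
have ub (x : R) : x < 0 -> (x%:E <= ereal_sup [set a%:E | a in `]-oo, 0%R[ : set R])%E.
  by move=> x0; apply: ereal_sup_ubound; exists x; rewrite //= in_itv.
case: ereal_sup ub => [r| |] ub; last 2 first.
- by rewrite leey.
- by have := ub (-1); rewrite ltrN10 => /(_ isT).
rewrite lee_fin leNgt; apply/negP => r0.
by have := ub (r / 2); rewrite lee_fin => /(_ ltac:(lra)); lra.
Qed.

Theorem theorem3 (R : realType) (D : set R[i])
  (D_lmi : is_lmi_region D)
  (D_unbounded : ~ bounded_set (D : set (R[i])^o))
  (D_real : real_section D = `]-oo, 0[%classic)
  (n : nat) (A : 'M[R]_n)
  (A_dom : diag_dominant D A) :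
  stable_in D A /\
  (forall E : 'M[R]_n, diag_pos_le1 E -> stable_in D (E *m A)).
Proof.
suff DA : forall E : 'M[R]_n, diag_pos_le1 E -> stable_in D (E *m A).
  split=> //; rewrite -[A]mul1mx; apply: DA.
  exists (const_mx 1); first by rewrite diag_const_mx.
  by move=> i; rewrite mxE ltr01 lexx.
move=> _ [d -> d01] [u v] /gershgorin[ i ].
have [_ [m [L [M [Lsym DE]]]]] := D_lmi.
have Dneg (a : R) : a < 0 -> D a%:C%C.
  by have -> : D a%:C%C = real_section D a by []; rewrite D_real /= in_itv.
have [_ + Ar] := A_dom i.
rewrite (right_end_neg D_real) lte_fin => Aii0.
have Dx : end_dist D (A i i) = (- A i i)%:E.
  rewrite /end_dist (right_end_neg D_real) (left_end_neg D_real) sube0.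
  by rewrite minEle leNgt /= ltry /= ltr0_norm.
have EA j : complexmx (diag_mx d *m A) i j = (d 0 i * A i j)%:C%C.
  by rewrite mxE mul_diag_mx mxE.
rewrite EA (eq_bigr (fun j => (d 0 i * `|A i j|)%:C%C)); last first.
  by move=> j _; rewrite EA normc_def /= expr0n addr0 sqrtr_sqr normrM gtr0_norm//; case/andP: (d01 i).
rewrite -rmorph_sum -mulr_sumr normc_def lecR /= subr0.
set S := \sum_(_ < _ | _) _ in Ar *.
have S0 : 0 <= S by exact: sumr_ge0.
move=> h.
have /andP[d0 d1] := d01 i.
have disc : (u - d 0 i * A i i) ^+ 2 + v ^+ 2 <= (d 0 i * S) ^+ 2.
  by rewrite -ler_sqrt ?sqr_ge0// sqrtr_sqr ger0_norm// mulr_ge0// ltW.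
have [u0 /ereal_sup_gt[_ [y /= Dxy <-]]] := disc_below_height Dx Aii0 (d01 i) S0 Ar disc.
rewrite lte_fin gt_max ltr_pdivrMr ?oppr_gt0// => /andP[vy xv].
apply: (cone_mem _ _ Dneg Dxy vy).
- by move=> s t z w; rewrite DE; exact: lmi_set_convex.
- by move=> z; rewrite DE; exact: lmi_set_conj.
- by rewrite [ltRHS]mulrC.
Qed.
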